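(* Let $n,m \in \mathbb{N}$ and let $g_1,\dots,g_m \in \mathbb{R}[\overline{X}]$, $\overline{X}=(X_1,\dots,X_n)$, be polynomials such that the quadratic module $M_g$ generated by $g=(g_1,\dots,g_m)$ in $\mathbb{R}[\overline{X}]$ is Archimedean. Then for every $L \in \mathbb{N}$ there exists $N \in \mathbb{N}$ such that every polynomial $f \in \mathbb{R}[\overline{X}]$ of degree at most $L$ satisfying $\|f\| \le L$ and $f(x) \ge \frac{1}{L}$ for all $x \in S_g$ belongs to the truncated quadratic module $M_g[N]$.
   Context: $\mathbb{N}=\{1,2,\dots\}$. $\deg$ is the total degree of a polynomial; the zero polynomial satisfies every upper degree bound. For each $L$, a norm $\|\cdot\|$ is fixed on the finite-dimensional real vector space of polynomials in $\mathbb{R}[\overline{X}]$ of degree at most $L$ (all norms on it are equivalent). $S_g=\{x\in\mathbb{R}^n \mid g_i(x)\ge 0 \text{ for all } i=1,\dots,m\}$. Let $\mathrm{SOS}$ denote the set of finite sums of squares of elements of $\mathbb{R}[\overline{X}]$. The quadratic module generated by $g$ is $$M_g=\{s_0+g_1s_1+\dots+g_ms_m \mid s_0,\dots,s_m\in\mathrm{SOS}\},$$ and for $N\in\mathbb{N}$ the truncated quadratic module is $$M_g[N]=\{s_0+g_1s_1+\dots+g_ms_m \mid s_0,\dots,s_m\in\mathrm{SOS},\ \deg(s_0)\le N,\ \deg(s_ig_i)\le N \text{ for } i=1,\dots,m\}.$$ $M_g$ is called Archimedean if for every $a\in\mathbb{R}[\overline{X}]$ there exists $N\in\mathbb{N}$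 with $a+N\in M_g$. *)

(* Defs.v *)
From HB Require Import structures.
From mathcomp Require Import all_boot all_order all_algebra.
From mathcomp Require Import classical_sets reals.
From mathcomp Require Import mpoly.
Set Implicit Arguments.
Unset Strict Implicit.
Unset Printing Implicit Defensive.
Import Order.TTheory GRing.Theory Num.Theory.
Local Open Scope ring_scope.

(* [msize p] is the total degree plus one, and [msize 0 = 0], so the zero
   polynomial satisfies every degree bound. *)
Definition deg_le (R : realType) (n : nat) (d : nat) (p : {mpoly R[n]}) : bool :=
  (msize p <= d.+1)%N.

(* Only the values of [nrm] on polynomials of degree at most [d] matter.
   Nonnegativity follows from these three axioms. *)
Definition is_norm_deg_le (R : realType) (n d : nat) (nrm : {mpoly R[n]} -> R) : Prop :=
  [/\ forall p q, deg_le d p -> deg_le d q -> nrm (p + q) <= nrm p + nrm q,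
      forall (c : R) p, deg_le d p -> nrm (c *: p) = `|c| * nrm p
    & forall p, deg_le d p -> nrm p = 0 -> p = 0].

Definition semialg (R : realType) (n m : nat) (g : m.-tuple {mpoly R[n]}) :
    set ('I_n -> R) :=
  [set x | forall i : 'I_m, 0 <= (tnth g i).@[x]]%classic.

Definition sos (R : realType) (n : nat) : set {mpoly R[n]} :=
  [set p | exists l : seq {mpoly R[n]}, p = \sum_(q <- l) q ^+ 2]%classic.

Definition quad_module (R : realType) (n m : nat) (g : m.-tuple {mpoly R[n]}) :
    set {mpoly R[n]} :=
  [set p | exists (s0 : {mpoly R[n]}) (s : m.-tuple {mpoly R[n]}),
    [/\ sos s0, forall i : 'I_m, sos (tnth s i)
      & p = s0 + \sum_(i < m) tnth g i * tnth s i]]%classic.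

Definition trunc_quad_module (R : realType) (n m : nat)
    (g : m.-tuple {mpoly R[n]}) (N : nat) : set {mpoly R[n]} :=
  [set p | exists (s0 : {mpoly R[n]}) (s : m.-tuple {mpoly R[n]}),
    [/\ sos s0 /\ (forall i : 'I_m, sos (tnth s i)),
        deg_le N s0,
        forall i : 'I_m, deg_le N (tnth s i * tnth g i)
      & p = s0 + \sum_(i < m) tnth g i * tnth s i]]%classic.

Definition archimedean (R : realType) (n m : nat)
    (g : m.-tuple {mpoly R[n]}) : Prop :=
  forall a : {mpoly R[n]},
    exists2 N : nat, (0 < N)%N & quad_module g (a + N%:R).

(* Main.v *)
Require Import Defs.
From HB Require Import structures.
From mathcomp Require Import all_boot all_order all_algebra.
From mathcomp Require Import classical_sets reals.
From mathcomp Require mpoly.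
From mathcomp Require Import ring lra.
From mathcomp Require boolp filter topology normedtype derive.
Import Order.TTheory GRing.Theory Num.Theory.
Local Open Scope ring_scope.

(* Putinar's theorem has the following elementary proof.  By the Archimedean
   hypothesis [b = c^2 - sum X_i^2] lies in [M_g] for some [c > 0].  Let [p > 0] on
   [S_g], and let [G_i] be [g_i] rescaled so that [|G_i| <= 1] on the cube
   [[-c,c]^n].  Subtracting from [p] the elements [G_i (1 - G_i)^(2k)] of [M_g]
   makes it positive on the whole cube once [k] is large: these are at most
   [1/(2k)] everywhere, and below any given bound where [G_i] is negative and
   bounded away from [0].  A polynomial positive on the cube has nonnegative
   Bernstein coefficients in large degree, hence lies in the preordering
   [SOS + b SOS], which contains [c + X_i] and [c - X_i] and is contained in [M_g].

   Uniformity: by norm equivalence the polynomials [f] in question have bounded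
   coefficients, so finitely many small cells cover them.  In a cell containing
   such an [f0], write [f = (f0 - 1/(2L)) + ((f - f0) + 1/(2L))]; the first summand
   depends on the cell only, and the second one has a representation of bounded
   degree because [M_g] contains [C +- X^e] for each of the finitely many monomials
   [X^e] of degree at most [L]. *)

Set Implicit Arguments.
Unset Strict Implicit.

(** * Compactness arguments on cubes of row vectors *)

(* [mpoly] and the topology files declare incompatible notations: the latter are
   imported in this module only, and the former only after it. *)
Module CompactCube.
Import filter topology normedtype derive.
Import numFieldNormedType.Exports.
Local Open Scope classical_set_scope.

Lemma continuous_pos_min (R : realType) (n : nat) (c : R) (u : 'rV[R]_n -> R) :
  0 <= c -> continuous u ->
  (forall v : 'rV[R]_n, (forall i, `|v ord0 i| <= c) -> 0 < u v) ->
  exists2 d, 0 < d & forall v : 'rV[R]_n, (forall i, `|v ord0 i| <= c) -> d <= u v.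
Proof.
move=> c0 cu u0.
pose A := [set v : 'rV[R]_n | forall i, `[- c, c]%classic (v ord0 i)].
have AE v : A v <-> (forall i, `|v ord0 i| <= c).
  by split=> H i; have := H i; rewrite /= in_itv /= -ler_norml.
have A0 : A !=set0 by exists 0; apply/AE => i; rewrite mxE normr0.
have cA : compact A.
  by apply: (@rV_compact R n (fun=> `[- c, c]%classic)) => i; exact: segment_compact.
have [|v vA vmin] := @EVT_min_rV R n u A A0 cA; first exact: continuous_subspaceT.
exists (u v); first by apply/u0/AE; rewrite inE in vA.
by move=> w /AE wA; apply: vmin; rewrite inE.
Qed.

Lemma continuous_bigsum (R : realType) (T : topologicalType) (I : Type) (r : seq I)
    (F : I -> T -> R) :
  (forall i, continuous (F i)) -> continuous (fun x => \sum_(i <- r) F i x).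
Proof. by move=> cF; apply: continuous_big => //; exact: add_continuous. Qed.

Lemma continuous_bigprod (R : realType) (T : topologicalType) (I : Type) (r : seq I)
    (F : I -> T -> R) :
  (forall i, continuous (F i)) -> continuous (fun x => \prod_(i <- r) F i x).
Proof. by move=> cF; apply: continuous_big => //; exact: mul_continuous. Qed.

Lemma continuous_norm_fun (R : realType) (T : topologicalType) (f : T -> R) :
  continuous f -> continuous (fun x => `|f x|).
Proof. by move=> cf x; apply: (@cvg_norm _ _ _ _ _ f); exact: cf. Qed.

Lemma continuous_fun_add (R : realType) (T : topologicalType) (f g : T -> R) :
  continuous f -> continuous g -> continuous (fun x => f x + g x).
Proof. by move=> cf cg x; apply: (@continuousD R R^o _ f g); [exact: cf | exact: cg]. Qed.

Lemma continuous_fun_sub (R : realType) (T : topologicalType) (f g : T -> R) :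
  continuous f -> continuous g -> continuous (fun x => f x - g x).
Proof. by move=> cf cg x; apply: (@continuousB R R^o _ f g); [exact: cf | exact: cg]. Qed.

Lemma continuous_coordX (R : realType) (n k : nat) (i : 'I_n) :
  continuous (fun v : 'rV[R]_n => v ord0 i ^+ k).
Proof.
have -> : (fun v : 'rV[R]_n => v ord0 i ^+ k) = fun v => \prod_(j < k) v ord0 i.
  by apply: boolp.funext => v; rewrite prodr_const card_ord.
by apply: continuous_bigprod => j; exact: coord_continuous.
Qed.

Lemma continuous_meval (R : realType) (n : nat) (p : mpoly.mpoly n R) :
  continuous (fun v : 'rV[R]_n => mpoly.meval (fun i => v ord0 i) p).
Proof.
under [X in continuous X]boolp.eq_fun do rewrite mpoly.mevalE.
apply: continuous_bigsum => k v; apply: continuousM; first exact: cst_continuous.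
by apply: continuous_bigprod => i; exact: continuous_coordX.
Qed.

(** This is comparison of a norm with the sup norm. The weighted l1 sum [q] dominates [phi], so
    [phi] is continuous; a positive lower bound on the Euclidean unit sphere then extends by
    homogeneity. *)
Lemma norm_lower_bound (R : realType) (n : nat) (phi : 'rV[R]_n -> R) :
  (forall v w, phi (v + w) <= phi v + phi w) ->
  (forall a v, phi (a *: v) = `|a| * phi v) ->
  (forall v, phi v = 0 -> v = 0) ->
  exists2 d : R, 0 < d & forall (v : 'rV[R]_n) i, d * `|v ord0 i| <= phi v.
Proof.
move=> phiD phiZ phi0.
have phi00 : phi 0 = 0 by rewrite -(scale0r 0) phiZ normr0 mul0r.
have phiN v : phi (- v) = phi v by rewrite -scaleN1r phiZ normrN1 mul1r.
have phi_ge0 v : 0 <= phi v.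
  by have := phiD v (- v); rewrite subrr phi00 phiN; lra.
have phiB v w : `|phi v - phi w| <= phi (v - w).
  have := phiD (v - w) w; have := phiD (w - v) v.
  rewrite !subrK -(opprB v w) phiN ler_norml => h1 h2.
  by apply/andP; split; lra.
pose q (v : 'rV[R]_n) := \sum_i `|v ord0 i| * phi (delta_mx ord0 i).
have phiq v : phi v <= q v.
  rewrite {1}(row_sum_delta v) /q.
  apply: (big_ind2 (fun a b => phi a <= b)) => //.
  - by move: phi00 => ->.
  - by move=> x1 x2 y1 y2 h1 h2; apply: le_trans (phiD _ _) (lerD h1 h2).
  - by move=> i _; rewrite phiZ.
have cphi : continuous phi.
  move=> v; apply/(@cvgrPdist_lt R R^o _ (nbhs v) _ phi) => e e0.
  have cq : continuous (fun w : 'rV[R]_n => q (v - w)).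
    apply: continuous_bigsum => i w.
    apply: (@continuousM R _ (fun w : 'rV[R]_n => `|(v - w) ord0 i|)
              (fun=> phi (delta_mx ord0 i))); last exact: cst_continuous.
    apply: continuous_norm_fun => {}w.
    apply: (@continuous_comp _ _ _ (fun w : 'rV[R]_n => v - w) (fun M : 'rV[R]_n => M ord0 i)).
      by apply: (@continuousB R 'rV[R]_n _ (fun=> v) id); [exact: cst_continuous | exact: cvg_id].
    exact: coord_continuous.
  have q0 : q (v - v) = 0 by rewrite subrr /q big1 // => i _; rewrite mxE normr0 mul0r.
  have cq0 : q (v - w) @[w --> (v : 'rV[R]_n)] --> (0 : R) by rewrite -[X in _ --> X]q0; exact: cq.
  near=> w.
  have h : `|0 - q (v - w)| < e by near: w; exact: (@cvgr_dist_lt R _ _ _ _ _ _ cq0).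
  rewrite sub0r normrN in h.
  by apply: le_lt_trans (phiB _ _) (le_lt_trans (phiq _) (le_lt_trans (ler_norm _) h)).
(* The added term is [1] at the origin and [0] on the unit sphere: the sum is positive on the whole
   cube [[-1,1]^n], and its minimum there bounds [phi] from below on the sphere. *)
have csq : continuous (fun v : 'rV[R]_n => phi v + `|1 - \sum_i v ord0 i ^+ 2|).
  apply: continuous_fun_add cphi _; apply: continuous_norm_fun.
  apply: continuous_fun_sub; first by move=> ?; exact: cst_continuous.
  by apply: continuous_bigsum => i; exact: continuous_coordX.
have [|d d0 dmin] := continuous_pos_min ler01 csq.
  move=> v _; rewrite lt_neqAle addr_ge0 // andbT eq_sym.
  apply/negP => /eqP /eqP; rewrite paddr_eq0 // => /andP[/eqP/phi0 -> ].
  by rewrite big1 ?subr0 ?normr1 ?oner_eq0 // => i _; rewrite mxE expr0n.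
exists d => // v i.
pose s2 := \sum_i v ord0 i ^+ 2.
have s2_ge0 : 0 <= s2 by apply: sumr_ge0 => j _; exact: sqr_ge0.
have vs j : `|v ord0 j| <= Num.sqrt s2.
  rewrite -sqrtr_sqr ler_sqrt // /s2 (bigD1 j) //= lerDl.
  by apply: sumr_ge0 => k _; exact: sqr_ge0.
have [s0|s_neq0] := eqVneq (Num.sqrt s2) 0.
  by have := vs i; rewrite s0 normr_le0 => /eqP ->; rewrite normr0 mulr0.
have s_gt0 : 0 < Num.sqrt s2 by rewrite lt_neqAle eq_sym s_neq0 sqrtr_ge0.
have := dmin ((Num.sqrt s2)^-1 *: v).
have -> : \sum_i ((Num.sqrt s2)^-1 *: v) ord0 i ^+ 2 = 1.
  under eq_bigr do rewrite mxE exprMn.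
  by rewrite -mulr_sumr exprVn sqr_sqrtr // mulVf // gt_eqF // -sqrtr_gt0.
rewrite subrr normr0 addr0 phiZ ger0_norm ?invr_ge0 ?sqrtr_ge0 // => h.
apply: le_trans (_ : d * Num.sqrt s2 <= _); first by rewrite ler_pM2l.
rewrite -ler_pdivlMr // mulrC; apply: h => j.
by rewrite mxE normrM normfV (ger0_norm (sqrtr_ge0 _)) mulrC ler_pdivrMr // mul1r.
Unshelve. all: end_near. Qed.

(** The function [u = 2 max(f,0) + 2 sum max(-g_i,0)] is continuous and vanishes only where [f <= 0]
    and every [g_i >= 0], hence nowhere on the cube; its minimum yields the margin. *)
Lemma pos_on_cube_margin (R : realType) (n m : nat) (c : R) (f : mpoly.mpoly n R)
    (g : 'I_m -> mpoly.mpoly n R) :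
  0 <= c ->
  (forall x : 'I_n -> R, (forall i, `|x i| <= c) ->
     (forall i, 0 <= mpoly.meval x (g i)) -> 0 < mpoly.meval x f) ->
  exists2 d, 0 < d & forall x : 'I_n -> R, (forall i, `|x i| <= c) ->
     (forall i, - d <= mpoly.meval x (g i)) -> d <= mpoly.meval x f.
Proof.
move=> c0 fpos.
pose ev p (v : 'rV[R]_n) := mpoly.meval (fun i => v ord0 i) p.
pose u v := `|ev f v| + ev f v + \sum_i (`|ev (g i) v| - ev (g i) v).
have cu : continuous u.
  apply: continuous_fun_add.
    apply: continuous_fun_add; last exact: continuous_meval.
    by apply: continuous_norm_fun; exact: continuous_meval.
  apply: continuous_bigsum => i; apply: continuous_fun_sub; last exact: continuous_meval.
  by apply: continuous_norm_fun; exact: continuous_meval.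
have f1 v : 0 <= `|ev f v| + ev f v by have := ler_norm (- ev f v); rewrite normrN; lra.
have g1 v i : 0 <= `|ev (g i) v| - ev (g i) v by have := ler_norm (ev (g i) v); lra.
have [|d d0 dmin] := continuous_pos_min c0 cu.
  move=> v vc; rewrite lt_neqAle addr_ge0 ?sumr_ge0 // andbT eq_sym.
  apply/negP; rewrite paddr_eq0 ?sumr_ge0 // psumr_eq0 // => /andP[/eqP hf /allP hg].
  have : 0 < ev f v.
    apply: fpos => // i; have /eqP := hg i (mem_index_enum i).
    by have := normr_ge0 (ev (g i) v); rewrite /ev; lra.
  by have := normr_ge0 (ev f v); lra.
have m0 : 0 < (m.+1%:R : R) by rewrite ltr0n.
(* With [e] this quotient, [g_i >= -e] for all [i] leaves [2 max(f,0) >= d - 2 m e = 2 e]. *)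
exists (d / (2 * m.+1%:R)); first by rewrite divr_gt0 // mulr_gt0.
move=> x xc xg; set e := d / _ in xg *.
have de : d = 2 * e + 2 * m%:R * e by rewrite /e -natr1; field; rewrite -natr1 in m0; lra.
have e0 : 0 < e by rewrite /e divr_gt0 // mulr_gt0.
pose v : 'rV[R]_n := \row_i x i.
have vx p : ev p v = mpoly.meval x p by apply: mpoly.meval_eq => i; rewrite mxE.
have : d <= u v by apply: dmin => i; rewrite mxE.
rewrite /u vx.
have : \sum_i (`|ev (g i) v| - ev (g i) v) <= \sum_(i < m) (2 * e).
  apply: ler_sum => i _; rewrite vx; have := xg i.
  by case: (lerP 0 (mpoly.meval x (g i))) => h h'; rewrite ?(ger0_norm h) ?(ltr0_norm h); lra.
rewrite sumr_const card_ord -[X in _ <= X -> _]mulr_natr => h1 h2.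
by move: h2; rewrite {1}de; case: (lerP 0 (mpoly.meval x f)) => h;
   rewrite ?(ger0_norm h) ?(ltr0_norm h); lra.
Qed.

End CompactCube.

(** * Bernstein expansions and positivity on the unit cube *)

Import mpoly.

(** Multiplied by [b! (d - b)!], both sides become [(j + d)!]. *)
Lemma bin_mul_ffact j d b : (b <= d)%N ->
  ('C(d, b) * (j + d) ^_ j = 'C(j + d, j + b) * (j + b) ^_ j)%N.
Proof.
move=> bd; apply/eqP; rewrite -(eqn_pmul2r (fact_gt0 b)) -(eqn_pmul2r (fact_gt0 (d - b))).
apply/eqP; transitivity ((j + d)`!).
  rewrite -(ffact_fact (leq_addr d j)) addKn -(bin_fact bd); ring.
rewrite -(bin_fact (_ : j + b <= j + d)%N) ?leq_add2l // subnDl.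
by rewrite -(ffact_fact (leq_addr b j)) addKn; ring.
Qed.

Section Bernstein.
Variable R : archiRealFieldType.

Definition bernstein (A : comAlgType R) (k a : nat) (y : A) : A :=
  (1 - y) ^+ (k - a) * y ^+ a *+ 'C(k, a).

(** For [j <= k] this is [C(a,j) / C(k,j)], the coefficient of [y ^+ j] at index [a] of the
    Bernstein basis of degree [k]. *)
Definition ffact_ratio (k a j : nat) : R := (a ^_ j)%:R / (k ^_ j)%:R.

(** Expand [y^j ((1 - y) + y)^(k - j)] by the binomial theorem; indices [a < j] contribute nothing
    since [a ^_ j = 0]. *)
Lemma exp_bernstein (A : comAlgType R) (j k : nat) (y : A) : (j <= k)%N ->
  y ^+ j = \sum_(a < k.+1) ffact_ratio k a j *: bernstein k a y.
Proof.
move=> /subnKC <-; set d := (k - j)%N; rewrite -addnS big_split_ord /= big1 ?add0r; last first.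
  by move=> i _; rewrite /ffact_ratio ffact_small // mul0r scale0r.
transitivity (y ^+ j * ((1 - y) + y) ^+ d); first by rewrite subrK expr1n mulr1.
rewrite exprDn mulr_sumr; apply: eq_bigr => b _; rewrite /bernstein subnDl exprD.
have bd : (b <= d)%N by rewrite -ltnS.
rewrite -scalerMnr scalerMnl mulrnAr -(@scaler_nat R A); congr (_ *: _); last by ring.
rewrite -[RHS]mulr_natr /ffact_ratio mulrAC -natrM [X in X%:R * _]mulnC -bin_mul_ffact // natrM mulfK //.
rewrite pnatr_eq0 -lt0n ffact_gt0.
exact: leq_addr.
Qed.

Lemma ffact_ratio_itv k a j : (a <= k)%N -> 0 <= ffact_ratio k a j <= 1.
Proof.
move=> ak; rewrite divr_ge0 ?ler0n //=.
(* For [j > k] the denominator is [0], whose inverse is [0] by convention. *)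
have [jk|kj] := leqP j k; last by rewrite /ffact_ratio [(k ^_ _)%N]ffact_small // invr0 mulr0.
rewrite ler_pdivrMr ?ltr0n ?ffact_gt0 // mul1r ler_nat.
elim: j jk => [|j IH] jk; rewrite ?ffactn0 // !ffactnSr leq_mul ?leq_sub2r //.
by apply: IH; exact: ltnW.
Qed.

(** Induction on [j]: the next ratio has the extra factor [t = (a - j) / (k - j)], which is within
    [j / k] of [a / k], and [j + j^2 <= (j + 1)^2]. *)
Lemma ffact_ratio_dist k a j : (0 < k)%N -> (j <= k)%N -> (a <= k)%N ->
  `|ffact_ratio k a j - (a%:R / k%:R) ^+ j| <= (j ^ 2)%:R / k%:R.
Proof.
move=> k0 jk ak; have k0' : 0 < (k%:R : R) by rewrite ltr0n.
have p01 : 0 <= (a%:R / k%:R : R) <= 1.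
  by rewrite divr_ge0 ?ler0n // ler_pdivrMr // mul1r ler_nat.
have [p0 p1] := andP p01.
elim: j jk => [|j IH] jk.
  by rewrite /ffact_ratio !ffactn0 divr1 expr0 subrr normr0 mul0r.
have {}IH := IH (ltnW jk).
have [r0 r1] := andP (ffact_ratio_itv j ak).
set t : R := (a - j)%N%:R / (k - j)%N%:R.
have -> : ffact_ratio k a j.+1 = ffact_ratio k a j * t.
  by rewrite /ffact_ratio !ffactnSr !natrM invfM /t; ring.
have kj0 : 0 < ((k - j)%N%:R : R) by rewrite ltr0n subn_gt0.
have tp : `|t - a%:R / k%:R| <= j%:R / k%:R.
  (* When [a < j], truncated subtraction gives [t = 0], and [a / k <= j / k]. *)
  have [ja|aj] := leqP j a; last first.
    rewrite /t (eqP (ltnW aj : (a - j == 0)%N)) mul0r sub0r normrN ger0_norm //.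
    by rewrite ler_pM2r ?invr_gt0 // ler_nat ltnW.
  rewrite /t (natrB _ ja) (natrB _ (ltnW jk)) in kj0 *.
  have -> : (a%:R - j%:R) / (k%:R - j%:R) - a%:R / k%:R =
     - (j%:R / k%:R * ((k%:R - a%:R) / (k%:R - j%:R))) :> R.
    by field; lra.
  have ajR : (j%:R : R) <= a%:R by rewrite ler_nat.
  have akR : (a%:R : R) <= k%:R by rewrite ler_nat.
  have jR : 0 <= (j%:R : R) by [].
  rewrite normrN ger0_norm; last by rewrite mulr_ge0 // divr_ge0 //; lra.
  rewrite ler_piMr //; first by rewrite divr_ge0 //; lra.
  by rewrite ler_pdivrMr // mul1r; lra.
rewrite exprSr.
have -> : ffact_ratio k a j * t - (a%:R / k%:R) ^+ j * (a%:R / k%:R) =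
  ffact_ratio k a j * (t - a%:R / k%:R)
   + (ffact_ratio k a j - (a%:R / k%:R) ^+ j) * (a%:R / k%:R) by ring.
apply: le_trans (ler_normD _ _) _.
rewrite (normrM (ffact_ratio k a j)) (normrM (_ - _)) (ger0_norm r0) (ger0_norm p0).
have h1 : ffact_ratio k a j * `|t - a%:R / k%:R| <= j%:R / k%:R.
  by apply: le_trans tp; rewrite ler_piMl.
have h2 : `|ffact_ratio k a j - (a%:R / k%:R) ^+ j| * (a%:R / k%:R) <= (j ^ 2)%:R / k%:R.
  by apply: le_trans IH; rewrite ler_piMr.
apply: le_trans (lerD h1 h2) _.
by rewrite -mulrDl -natrD ler_pM2r ?invr_gt0 // ler_nat -!mulnn mulSn mulnS leq_add ?leq_addl.
Qed.

(** Factors are exchanged one at a time; the others lie in [[0,1]] and do not amplify the error. *)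
Lemma dist_prod_le (I : Type) (s : seq I) (u v : I -> R) :
  (forall i, 0 <= u i <= 1) -> (forall i, 0 <= v i <= 1) ->
  `|\prod_(i <- s) u i - \prod_(i <- s) v i| <= \sum_(i <- s) `|u i - v i|.
Proof.
move=> u01 v01; elim: s => [|i s IH]; first by rewrite !big_nil subrr normr0.
rewrite !big_cons.
set U := \prod_(j <- s) u j in IH *; set V := \prod_(j <- s) v j in IH *.
have [V0 V1] : 0 <= V /\ V <= 1.
  split; first by apply: prodr_ge0 => j _; case/andP: (v01 j).
  by rewrite /V; apply: prodr_ile1 => j _.
have -> : u i * U - v i * V = u i * (U - V) + (u i - v i) * V by ring.
apply: le_trans (ler_normD _ _) _; rewrite addrC !normrM (ger0_norm V0).
have /andP[ui0 ui1] := u01 i; rewrite (ger0_norm ui0).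
by apply: lerD; [rewrite ler_piMr | apply: le_trans IH; rewrite ler_piMl].
Qed.

(** The bound on [msize H] keeps every exponent at most [k], so [exp_bernstein] applies to each
    variable separately; distributing the product over the sums gives the tensor Bernstein form. *)
Lemma comp_mpoly_bernstein (n l k : nat) (H : {mpoly R[n]}) (Y : n.-tuple {mpoly R[l]}) :
  (msize H <= k)%N ->
  H \mPo Y = \sum_(a : {ffun 'I_n -> 'I_k.+1})
    (\sum_(e <- msupp H) H@_e * \prod_i ffact_ratio k (a i) (e i))
      *: \prod_i bernstein k (a i) (tnth Y i).
Proof.
move=> Hk; under eq_bigr do rewrite scaler_suml.
rewrite comp_mpolyE exchange_big /=; apply: eq_big_seq => e eH.
under [RHS]eq_bigr do rewrite -scalerA.
rewrite -scaler_sumr; congr (_ *: _).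
under [RHS]eq_bigr do rewrite -scaler_prod.
rewrite -(bigA_distr_bigA (fun i (b : 'I_k.+1) =>
  ffact_ratio k b (e i) *: bernstein k b (tnth Y i))).
apply: eq_bigr => i _; apply: exp_bernstein.
apply: leq_trans Hk; apply: ltnW; apply: leq_ltn_trans (msize_mdeg_lt eH).
by rewrite mdegE (bigD1 i) //= leq_addr.
Qed.

(* Bernstein coefficients of [H] converge to its values at the grid points, so
   they are all nonnegative once the degree is large. *)
Lemma comp_mpoly_semiring (n l : nat) (T : {mpoly R[l]} -> Prop) (H : {mpoly R[n]})
    (Y : n.-tuple {mpoly R[l]}) (d : R) :
  (forall c : R, 0 <= c -> T c%:MP) ->
  (forall p q, T p -> T q -> T (p + q)) -> (forall p q, T p -> T q -> T (p * q)) ->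
  (forall i, T (tnth Y i)) -> (forall i, T (1 - tnth Y i)) ->
  0 < d -> (forall x : 'I_n -> R, (forall i, 0 <= x i <= 1) -> d <= H.@[x]) ->
  T (H \mPo Y).
Proof.
move=> Tc TD TM TY TY1 d0 Hd.
have T0 : T 0 by rewrite -mpolyC0; exact: Tc.
have T1 : T 1 by rewrite -mpolyC1; exact: Tc.
have Tprod (I : Type) (s : seq I) F : (forall i, T (F i)) -> T (\prod_(i <- s) F i).
  by move=> TF; apply: (big_ind T).
(* [D / k] bounds the distance from a Bernstein coefficient of degree [k] to the value of [H] at the
   grid point [a / k]; [k] is taken large enough that [D / k <= d]. *)
pose D := \sum_(e <- msupp H) `|H@_e| * \sum_i (e i ^ 2)%:R.
have D0 : 0 <= D by apply: sumr_ge0 => e _; rewrite mulr_ge0 // sumr_ge0.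
pose k := (Num.bound (D / d) + msize H).+1.
have k0 : 0 < (k%:R : R) by rewrite ltr0n.
have Dk : D / k%:R <= d.
  rewrite ler_pdivrMr // mulrC -ler_pdivrMr //.
  apply: le_trans (ltW (archi_boundP _)) _; first by rewrite divr_ge0 // ltW.
  by rewrite ler_nat /k -addnS leq_addr.
have Hk : (msize H <= k)%N by rewrite /k -addSn leq_addl.
rewrite (comp_mpoly_bernstein Y Hk); apply: (big_ind T) => // a _.
rewrite -mul_mpolyC; apply: (TM); last first.
  apply: (Tprod) => i; rewrite /bernstein -(@scaler_nat R) -mul_mpolyC.
  apply: (TM); first exact: Tc.
  by apply: (TM); rewrite -[X in _ ^+ X]card_ord -prodr_const; apply: (Tprod).
apply: Tc; pose x i : R := (a i)%:R / k%:R.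
have aik i : (a i <= k)%N by rewrite -ltnS.
have x01 i : 0 <= x i <= 1.
  by rewrite divr_ge0 ?ler0n // ler_pdivrMr // mul1r ler_nat aik.
have := Hd x x01; rewrite mevalE => Hx.
set C := \sum_(e <- msupp H) _.
suff : `|C - \sum_(e <- msupp H) H@_e * \prod_i x i ^+ e i| <= d.
  by rewrite ler_norml => /andP[h _]; lra.
apply: le_trans Dk; rewrite /C -sumrB /D mulr_suml.
apply: le_trans (ler_norm_sum _ _ _) _; rewrite big_seq [leRHS]big_seq.
apply: ler_sum => e eH; rewrite -mulrBr normrM -mulrA ler_wpM2l //.
apply: le_trans (dist_prod_le _ _ _) _.
- by move=> i; exact: ffact_ratio_itv.
- by move=> i; have /andP[h0 h1] := x01 i; rewrite exprn_ge0 //= exprn_ile1.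
rewrite mulr_suml; apply: ler_sum => i _; apply: ffact_ratio_dist => //.
apply: leq_trans Hk; apply: ltnW; apply: leq_ltn_trans (msize_mdeg_lt eH).
by rewrite mdegE (bigD1 i) //= leq_addr.
Qed.

End Bernstein.

(** * Sums of squares and quadratic modules *)

Section Putinar.
Variables (R : realType) (n : nat).
Implicit Types (p q s t : {mpoly R[n]}).

Lemma sos_sqr p : sos (p ^+ 2).
Proof. by exists [:: p]; rewrite big_seq1. Qed.

Lemma sosC (c : R) : 0 <= c -> sos (c%:MP : {mpoly R[n]}).
Proof. by move=> c0; rewrite -(sqr_sqrtr c0) rmorphXn; exact: sos_sqr. Qed.

Lemma sosD p q : sos p -> sos q -> sos (p + q).
Proof. by move=> [l ->] [l' ->]; exists (l ++ l'); rewrite big_cat. Qed.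

Lemma sosM p q : sos p -> sos q -> sos (p * q).
Proof.
move=> [l ->] [l' ->]; exists [seq x * y | x <- l, y <- l'].
rewrite big_allpairs_dep mulr_suml; apply: eq_bigr => x _.
by rewrite mulr_sumr; apply: eq_bigr => y _; rewrite exprMn.
Qed.

Lemma sos0 : sos (0 : {mpoly R[n]}).
Proof. by exists [::]; rewrite big_nil. Qed.

Lemma sos_sum_sqr (P : pred 'I_n) : sos (\sum_(i | P i) 'X_i ^+ 2 : {mpoly R[n]}).
Proof. by apply: (big_ind (@sos R n)) => [||i _]; [exact: sos0 | exact: sosD | exact: sos_sqr]. Qed.

Section QuadraticModule.
Variables (m : nat) (g : m.-tuple {mpoly R[n]}).

Lemma quad_moduleD p q : quad_module g p -> quad_module g q -> quad_module g (p + q).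
Proof.
move=> [s0 [s [hs0 hs ->]]] [t0 [t [ht0 ht ->]]].
exists (s0 + t0), [tuple tnth s i + tnth t i | i < m]; split.
- exact: sosD.
- by move=> i; rewrite tnth_mktuple; exact: sosD.
- under [in RHS]eq_bigr do rewrite tnth_mktuple mulrDr.
  by rewrite big_split /=; ring.
Qed.

Lemma quad_module_sosM p q : sos p -> quad_module g q -> quad_module g (p * q).
Proof.
move=> hp [s0 [s [hs0 hs ->]]].
exists (p * s0), [tuple p * tnth s i | i < m]; split.
- exact: sosM.
- by move=> i; rewrite tnth_mktuple; exact: sosM.
- rewrite mulrDr mulr_sumr; congr (_ + _); apply: eq_bigr => i _.
  by rewrite tnth_mktuple; ring.
Qed.

Lemma quad_module_sos p : sos p -> quad_module g p.
Proof.
move=> hp; exists p, [tuple 0 | i < m]; split => //.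
  by move=> i; rewrite tnth_mktuple; exact: sos0.
by rewrite big1 ?addr0 // => i _; rewrite tnth_mktuple mulr0.
Qed.

Lemma quad_module_gen p i : sos p -> quad_module g (tnth g i * p).
Proof.
move=> hp; exists 0, [tuple if j == i then p else 0 | j < m]; split.
- exact: sos0.
- by move=> j; rewrite tnth_mktuple; case: ifP => // _; exact: sos0.
- rewrite add0r (bigD1 i) //= tnth_mktuple eqxx big1 ?addr0 // => j /negPf ji.
  by rewrite tnth_mktuple ji mulr0.
Qed.

End QuadraticModule.

(** * The preordering generated by the ball polynomial *)

Section Ball.
Variable c : R.
Hypothesis c0 : 0 < c.

Definition ball_poly : {mpoly R[n]} := (c ^+ 2)%:MP - \sum_i 'X_i ^+ 2.

Definition ball_preorder p := exists s t, [/\ sos s, sos t & p = s + ball_poly * t].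

Lemma ball_preorder_sos p : sos p -> ball_preorder p.
Proof. by move=> hp; exists p, 0; split=> //; [exact: sos0 | rewrite mulr0 addr0]. Qed.

Lemma ball_preorderD p q : ball_preorder p -> ball_preorder q -> ball_preorder (p + q).
Proof.
move=> [s [t [hs ht ->]]] [s' [t' [hs' ht' ->]]]; exists (s + s'), (t + t').
by split; [exact: sosD | exact: sosD | ring].
Qed.

(** With a single generator the only new product is [ball_poly ^+ 2], itself a square. *)
Lemma ball_preorderM p q : ball_preorder p -> ball_preorder q -> ball_preorder (p * q).
Proof.
move=> [s [t [hs ht ->]]] [s' [t' [hs' ht' ->]]].
exists (s * s' + ball_poly ^+ 2 * (t * t')), (t * s' + s * t').
split; [| by apply: sosD; exact: sosM | ring].
by apply: sosD; [exact: sosM | apply: sosM; [exact: sos_sqr | exact: sosM]].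
Qed.

(* [2c (c + l) = (c + l)^2 + (c^2 - l^2)] *)
Lemma ball_preorder_linear i (l : {mpoly R[n]}) : l ^+ 2 = 'X_i ^+ 2 ->
  ball_preorder ((2 * c)^-1 *: (l + c%:MP)).
Proof.
move=> li; pose a : R := (2 * c)^-1 / (2 * c).
have a0 : 0 <= a by rewrite divr_ge0 // ?invr_ge0 mulr_ge0 // ltW.
(* Here [c^2 - l^2] is [ball_poly] plus the squares of the other variables, and [a = 1 / (4 c^2)]
   absorbs the scaling. *)
exists (a%:MP * ((l + c%:MP) ^+ 2 + \sum_(j | j != i) 'X_j ^+ 2)), a%:MP.
split; [| exact: sosC |].
  by apply: sosM; [exact: sosC | apply: sosD; [exact: sos_sqr | exact: sos_sum_sqr]].
rewrite /ball_poly [X in _ - X](bigD1 i) //= -li -mul_mpolyC rmorphXn /=.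
have -> : ((2 * c)^-1)%:MP = a%:MP * (2%:MP * c%:MP) :> {mpoly R[n]}.
  by rewrite -!mpolyCM; congr _%:MP; rewrite /a mulfVK // mulf_neq0 // gt_eqF.
have -> : (2 : R)%:MP = 2 :> {mpoly R[n]} by rewrite mpolyC_nat.
by ring.
Qed.

Lemma comp_mpoly_cancel p (lp lq : n.-tuple {mpoly R[n]}) :
  (forall i, tnth lp i \mPo lq = 'X_i) -> (p \mPo lp) \mPo lq = p.
Proof.
move=> lpq; rewrite (comp_mpolyE p lp) raddf_sum [RHS]mpolyE; apply: eq_bigr => e _ /=.
rewrite comp_mpolyZ rmorph_prod mpolyXE_id; congr (_ *: _).
by apply: eq_bigr => i _; rewrite rmorphXn /= lpq.
Qed.

(** The affine map [lp] sends the unit cube onto [[-c,c]^n] and [lq] is its inverse. Thus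
    [p \mPo lp] is at least [d] on the unit cube, and substituting [lq] recovers [p]. *)
Lemma ball_preorder_pos p (d : R) : 0 < d ->
  (forall x : 'I_n -> R, (forall i, `|x i| <= c) -> d <= p.@[x]) -> ball_preorder p.
Proof.
move=> d0 pd.
pose lp := [tuple (2 * c) *: 'X_i - c%:MP : {mpoly R[n]} | i < n].
pose lq := [tuple (2 * c)^-1 *: ('X_i + c%:MP) : {mpoly R[n]} | i < n].
have c2 : 2 * c != 0 by rewrite mulf_neq0 // gt_eqF.
rewrite -(@comp_mpoly_cancel p lp lq); last first.
  move=> i; rewrite tnth_mktuple comp_mpolyB comp_mpolyZ comp_mpolyXU comp_mpolyC.
  by rewrite -tnth_nth tnth_mktuple scalerA mulfV // scale1r addrK.
apply: (@comp_mpoly_semiring R n n ball_preorder _ lq d) => //.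
- by move=> a a0; apply/ball_preorder_sos/sosC.
- exact: ball_preorderD.
- exact: ball_preorderM.
- by move=> i; rewrite tnth_mktuple; exact: (@ball_preorder_linear i).
- move=> i; rewrite tnth_mktuple.
  have -> : 1 - (2 * c)^-1 *: ('X_i + c%:MP) = (2 * c)^-1 *: (- 'X_i + c%:MP) :> {mpoly R[n]}.
    have -> : 1 = (2 * c)^-1 *: (2 * c)%:MP :> {mpoly R[n]}.
      by rewrite -mul_mpolyC -mpolyCM mulVf // mpolyC1.
    by rewrite -scalerBr; congr (_ *: _); rewrite mpolyCM mpolyC_nat; ring.
  by apply: (@ball_preorder_linear i); rewrite sqrrN.
- move=> x x01; rewrite comp_mpoly_meval; apply: pd => i; rewrite tnth_mktuple.
  rewrite mevalB mevalZ mevalXU mevalC; have /andP[h0 h1] := x01 i.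
  have h2 := mulr_ge0 (ltW c0) h0; have h3 : c * x i <= c by rewrite ler_piMr // ltW.
  by rewrite ler_norml; apply/andP; split; lra.
Qed.

End Ball.

(** * Estimates on the cube and Putinar's theorem *)

Lemma meval_bounded (c : R) p :
  exists2 B, 0 <= B & forall x : 'I_n -> R, (forall i, `|x i| <= c) -> `|p.@[x]| <= B.
Proof.
exists (\sum_(e <- msupp p) `|p@_e| * \prod_i `|c| ^+ e i).
  by apply: sumr_ge0 => e _; rewrite mulr_ge0 // prodr_ge0 // => i _; exact: exprn_ge0.
move=> x xc; rewrite mevalE; apply: le_trans (ler_norm_sum _ _ _) _.
apply: ler_sum => e _; rewrite normrM ler_wpM2l // normr_prod.
apply: ler_prod => i _; rewrite normr_ge0 normrX lerXn2r //= ?nnegrE //.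
by apply: le_trans (xc i) (ler_norm c).
Qed.

Lemma bernoulli_le (t : R) k : 0 <= t -> 1 + k%:R * t <= (1 + t) ^+ k.
Proof.
move=> t0; elim: k => [|k IH]; first by rewrite mul0r addr0.
have k0 : 0 <= (k%:R : R) by [].
by rewrite exprS -natr1; nra.
Qed.

(** For [t > 0], Bernoulli gives [2k t <= (1 + t)^(2k)], while [(1 - t)^(2k) (1 + t)^(2k) <= 1]. For
    [t <= 0] the left side is nonpositive. *)
Lemma mul_exp1B_le (t : R) k : (0 < k)%N -> `|t| <= 1 -> t * (1 - t) ^+ k.*2 <= k.*2%:R^-1.
Proof.
move=> k0 t1; have [h1 h2] : - 1 <= t /\ t <= 1 by move: t1; rewrite ler_norml => /andP.
have K0 : 0 < (k.*2%:R : R) by rewrite ltr0n double_gt0.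
have [t0|t0] := lerP t 0.
  apply: le_trans (_ : 0 <= _); last by rewrite invr_ge0 ltW.
  by rewrite mulr_le0_ge0 // exprn_ge0 // subr_ge0.
rewrite -[leRHS]mul1r ler_pdivlMr //.
have B := @bernoulli_le t k.*2 (ltW t0).
have P : (1 - t) ^+ k.*2 * (1 + t) ^+ k.*2 <= 1.
  by rewrite -exprMn exprn_ile1 //; nra.
have Q : 0 <= (1 - t) ^+ k.*2 by rewrite exprn_ge0 // subr_ge0.
by nra.
Qed.

Theorem putinar m (g : m.-tuple {mpoly R[n]}) p : archimedean g ->
  (forall x : 'I_n -> R, semialg g x -> 0 < p.@[x]) -> quad_module g p.
Proof.
move=> hg ppos.
have [N N0 hN] := hg (- \sum_i 'X_i ^+ 2).
pose c : R := N%:R; have c0 : 0 < c by rewrite ltr0n.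
have hb : quad_module g (ball_poly c).
  (* The hypothesis provides [N - sum X_i^2]; as [N >= 1], adding the nonnegative constant [N^2 - N]
     gives the ball of radius [c = N]. *)
  have -> : ball_poly c = (- \sum_i 'X_i ^+ 2 + N%:R) + (c ^+ 2 - c)%:MP.
    by rewrite /ball_poly mpolyCB mpolyC_nat; ring.
  apply: quad_moduleD hN _; apply/quad_module_sos/sosC.
  by rewrite subr_ge0 expr2 ler_peMl ?ler1n // ltW.
have preM q : ball_preorder c q -> quad_module g q.
  move=> [s [t [hs ht ->]]]; apply: quad_moduleD; first exact: quad_module_sos.
  by rewrite mulrC; exact: quad_module_sosM.
have [|d d0 hd] := @CompactCube.pos_on_cube_margin R n m c p (tnth g) (ltW c0).
  by move=> x _ xg; exact: ppos.
have [F F0 hF] := meval_bounded c p.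
have /boolp.choice[B hB] : forall i : 'I_m, exists B, 0 <= B /\
    forall x : 'I_n -> R, (forall j, `|x j| <= c) -> `|(tnth g i).@[x]| <= B.
  by move=> i; have [B B0 hB] := meval_bounded c (tnth g i); exists B.
pose C := 1 + \sum_i B i.
have C0 : 0 < C by rewrite ltr_pwDl // sumr_ge0 // => i _; case: (hB i).
pose d' := d / C; have d'0 : 0 < d' by rewrite divr_gt0.
(* The first bound makes the [m] terms, each at most [1 / K], total at most [d / 2]; the second
   makes a single very negative term outweigh [F + d]. *)
pose k := (Num.bound (m%:R * 2 / d) + Num.bound ((F + d) / d' ^+ 2)).+1.
pose K : R := k.*2%:R.
have kK : (k%:R : R) <= K by rewrite ler_nat -addnn leq_addr.
have K0 : 0 < K by rewrite ltr0n.
have K1 : m%:R / K <= d / 2.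
  rewrite ler_pdivrMr // -ler_pdivrMl ?divr_gt0 // invf_div mulrC mulrA.
  apply: le_trans kK; apply: le_trans (ltW (archi_boundP _)) _.
    by rewrite divr_ge0 ?mulr_ge0 // ltW.
  by rewrite ler_nat /k -addnS leq_addr.
have K2 : F + d <= K * d' ^+ 2.
  rewrite -ler_pdivrMr ?exprn_gt0 //.
  apply: le_trans kK; apply: le_trans (ltW (archi_boundP _)) _.
    by rewrite divr_ge0 ?exprn_ge0 ?addr_ge0 // ltW.
  by rewrite ler_nat /k -addSn leq_addl.
pose G i := C^-1 *: tnth g i.
pose h := p - \sum_i G i * (1 - G i) ^+ k.*2.
(* The even exponent makes each multiplier of [tnth g i] a nonnegative constant times a square. *)
have -> : p = h + \sum_i tnth g i * (C^-1%:MP * ((1 - G i) ^+ k) ^+ 2).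
  rewrite -[LHS](subrK (\sum_i G i * (1 - G i) ^+ k.*2)); congr (_ + _).
  by apply: eq_bigr => i _; rewrite -exprM muln2 /G -mul_mpolyC; ring.
apply: quad_moduleD; last first.
  apply: (big_ind (quad_module g)) => [||i _].
  - by apply: quad_module_sos; exact: sos0.
  - exact: quad_moduleD.
  - apply/quad_module_gen/sosM; last exact: sos_sqr.
    by apply: sosC; rewrite invr_ge0 ltW.
apply: preM; apply: (@ball_preorder_pos c c0 h (d / 2)); first by rewrite divr_gt0.
move=> x xc; pose u i := (G i).@[x].
have hx : h.@[x] = p.@[x] - \sum_i u i * (1 - u i) ^+ k.*2.
  rewrite /h mevalB; congr (_ - _); rewrite raddf_sum; apply: eq_bigr => i _ /=.
  by rewrite mevalM rmorphXn /= mevalB meval1.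
have uE i : u i = (tnth g i).@[x] / C by rewrite /u /G mevalZ mulrC.
have u1 i : `|u i| <= 1.
  rewrite uE normrM normfV (gtr0_norm C0) ler_pdivrMr // mul1r.
  apply: le_trans ((hB i).2 x xc) _; rewrite /C (bigD1 i) //=.
  have : 0 <= \sum_(j | j != i) B j by apply: sumr_ge0 => j _; exact: (hB j).1.
  lra.
have term i : u i * (1 - u i) ^+ k.*2 <= K^-1 by exact: mul_exp1B_le.
(* If no [u i] is below [- d'], then [p >= d] at [x] and the sum costs at most [d / 2]. Otherwise
   term [i] contributes at least [F + d], against [p >= -F] and at most [d / 2] lost to the
   others. *)
have [/existsP[i ui]|] := boolP [exists i, u i < - d']; last first.
  rewrite negb_exists => /forallP ud.
  have fd : d <= p.@[x].
    apply: hd => // i; have := ud i; rewrite -leNgt uE ler_pdivlMr //.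
    by rewrite mulNr divfK // gt_eqF.
  have : \sum_i u i * (1 - u i) ^+ k.*2 <= \sum_(i < m) K^-1 by apply: ler_sum.
  rewrite sumr_const card_ord -mulr_natl hx; lra.
have others : \sum_(j | j != i) u j * (1 - u j) ^+ k.*2 <= m%:R / K.
  apply: le_trans (_ : \sum_(j < m | j != i) K^-1 <= _); first by apply: ler_sum.
  rewrite sumr_const -[leLHS]mulr_natl ler_pM2r ?invr_gt0 // ler_nat.
  by rewrite -[X in (_ <= X)%N](card_ord m) max_card.
have := hF x xc; rewrite ler_norml => /andP[Fx _].
(* Bernoulli at [- u i > d'] gives [(1 - u i)^K >= K d']. *)
have ui' : d' * K * d' <= - (u i * (1 - u i) ^+ k.*2).
  rewrite -mulNr; have B1 := @bernoulli_le (- u i) k.*2; rewrite -/K in B1.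
  have {}B1 : 1 + K * - u i <= (1 - u i) ^+ k.*2 by apply: B1; lra.
  rewrite -mulrA; apply: ler_pM; [lra | | lra |].
    by rewrite mulr_ge0 // ltW.
  apply: le_trans B1; apply: le_trans (_ : K * - u i <= _); last by rewrite lerDr.
  by rewrite ler_wpM2l ?(ltW K0) //; lra.
have dd : d' * K * d' = K * d' ^+ 2 by ring.
rewrite hx (bigD1 i) //=; rewrite dd in ui'; lra.
Qed.

End Putinar.

(** * Degree bounds uniform over a bounded set of polynomials *)

Section Uniformity.
Variables (R : realType) (n : nat).
Implicit Types (p q s t f : {mpoly R[n]}).

Lemma deg_leD N p q : deg_le N p -> deg_le N q -> deg_le N (p + q).
Proof. by move=> hp hq; apply: leq_trans (msizeD_le p q) _; rewrite geq_max; apply/andP. Qed.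

Lemma deg_leZ N (c : R) p : deg_le N p -> deg_le N (c *: p).
Proof. by move=> hp; apply: leq_trans (msizeZ_le p c) hp. Qed.

Lemma deg_le0 N : deg_le N (0 : {mpoly R[n]}).
Proof. by rewrite /deg_le msize0. Qed.

Lemma mcoeff_bsum k (c : 'X_{1..n < k} -> R) (e : 'X_{1..n < k}) :
  (\sum_(d : 'X_{1..n < k}) c d *: 'X_[d])@_e = c e.
Proof.
rewrite raddf_sum (bigD1 e) //= mcoeffZ mcoeffX eqxx mulr1 big1 ?addr0 // => d.
by rewrite bmeqP => /negPf de; rewrite mcoeffZ mcoeffX de mulr0.
Qed.

Lemma deg_le_bsum L (c : 'X_{1..n < L.+1} -> R) :
  deg_le L (\sum_(d : 'X_{1..n < L.+1}) c d *: 'X_[d]).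
Proof.
apply: (big_ind (deg_le L)) => [||d _]; [exact: deg_le0 | exact: deg_leD |].
by apply: deg_leZ; rewrite /deg_le msizeX; exact: bmdeg.
Qed.

Lemma norm_mcoeff_bound L (nrm : {mpoly R[n]} -> R) (r : R) : is_norm_deg_le L nrm ->
  exists2 B, 0 < B & forall p, deg_le L p -> nrm p <= r ->
    forall e : 'X_{1..n < L.+1}, `|p@_e| <= B.
Proof.
move=> [nD nZ n0].
(* Row vectors indexed by the monomials of degree at most [L] parametrize exactly the space on which
   [nrm] is a norm. *)
pose P (v : 'rV[R]_#|{: 'X_{1..n < L.+1}}|) : {mpoly R[n]} :=
  \sum_(e : 'X_{1..n < L.+1}) v ord0 (enum_rank e) *: 'X_[e].
have degP v : deg_le L (P v) by exact: deg_le_bsum.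
have PD v w : P (v + w) = P v + P w.
  by rewrite /P -big_split; apply: eq_bigr => e _; rewrite mxE scalerDl.
have PZ a v : P (a *: v) = a *: P v.
  by rewrite /P scaler_sumr; apply: eq_bigr => e _; rewrite mxE scalerA.
have [||| d d0 hd] := @CompactCube.norm_lower_bound R _ (nrm \o P).
- by move=> v w; rewrite /= PD; exact: nD.
- by move=> a v; rewrite /= PZ; exact: nZ.
- move=> v /= /(n0 _ (degP v)) Pv; apply/rowP => i; rewrite mxE.
  by have := mcoeff_bsum (fun e => v ord0 (enum_rank e)) (enum_val i); rewrite -/(P v) Pv mcoeff0 enum_valK.
exists (`|r| / d + 1); first by rewrite ltr_wpDl // divr_ge0 // ltW.
move=> p pL pr e; pose v : 'rV[R]_#|{: 'X_{1..n < L.+1}}| := \row_i p@_(enum_val i : 'X_{1..n < L.+1}).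
have Pv : P v = p.
  by rewrite [RHS](mpolywE pL); apply: eq_bigr => d' _; rewrite mxE enum_rankK.
have := hd v (enum_rank e); rewrite /= Pv mxE enum_rankK => h.
apply: le_trans (_ : `|r| / d <= _); last by rewrite lerDl.
by rewrite ler_pdivlMr // mulrC (le_trans h) // (le_trans pr) // ler_norm.
Qed.

(** Asking for [P] beyond a threshold builds monotonicity into the statement, so the maximum of the
    thresholds works. *)
Lemma finite_uniform_bound (I : finType) (P : I -> nat -> Prop) :
  (forall i, exists N, forall N', (N <= N')%N -> P i N') ->
  exists N, forall i N', (N <= N')%N -> P i N'.
Proof.
move=> /boolp.choice[N hN]; exists (\max_i N i)%N => i N' NN'.
by apply: hN; apply: leq_trans NN'; exact: leq_bigmax.
Qed.

Lemma finite_net (k : nat) (B eta : R) : 0 < eta ->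
  exists (I : finType) (cell : {mpoly R[n]} -> I), forall p q,
    (forall e : 'X_{1..n < k}, `|p@_e| <= B) -> (forall e : 'X_{1..n < k}, `|q@_e| <= B) ->
    cell p = cell q -> forall e : 'X_{1..n < k}, `|p@_e - q@_e| <= eta.
Proof.
move=> eta0; pose K := Num.truncn (2 * B / eta).
pose h p (e : 'X_{1..n < k}) := (p@_e + B) / eta.
(* A cell records each coefficient rounded down to a grid of mesh [eta] starting at [- B]. Outside
   the box [inord] may return a default index, hence the bounds required of [p] and [q]. *)
exists {ffun 'X_{1..n < k} -> 'I_K.+1}, (fun p => [ffun e => inord (Num.truncn (h p e))]).
have h0 p (e : 'X_{1..n < k}) : `|p@_e| <= B -> 0 <= h p e.
  by rewrite ler_norml => /andP[h1 h2]; rewrite divr_ge0 ?(ltW eta0) //; lra.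
have hK p (e : 'X_{1..n < k}) : `|p@_e| <= B -> (Num.truncn (h p e) < K.+1)%N.
  move=> pB; rewrite ltnS; apply: le_truncn; rewrite ler_pM2r ?invr_gt0 //.
  by move: pB; rewrite ler_norml => /andP[h1 h2]; lra.
move=> p q pB qB /ffunP pq e; have := pq e; rewrite !ffunE => /(congr1 val).
rewrite /= !inordK ?hK // => tpq.
have /andP[p1 p2] := truncn_itv (h0 p e (pB e)).
have /andP[q1 q2] := truncn_itv (h0 q e (qB e)).
rewrite tpq in p1 p2; rewrite -natr1 in p2 q2.
have -> : p@_e - q@_e = (h p e - h q e) * eta by rewrite /h; field; rewrite gt_eqF.
rewrite normrM (gtr0_norm eta0) ler_piMl ?(ltW eta0) // ler_norml.
by apply/andP; split; lra.
Qed.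

Variables (m : nat) (g : m.-tuple {mpoly R[n]}).

Lemma trunc_quad_moduleD N p q :
  trunc_quad_module g N p -> trunc_quad_module g N q -> trunc_quad_module g N (p + q).
Proof.
move=> [s0 [s [[hs0 hs] ds0 ds ->]]] [t0 [t [[ht0 ht] dt0 dt ->]]].
exists (s0 + t0), [tuple tnth s i + tnth t i | i < m]; split.
- by split; [exact: sosD | move=> i; rewrite tnth_mktuple; exact: sosD].
- exact: deg_leD.
- by move=> i; rewrite tnth_mktuple mulrDl; exact: deg_leD.
- under [in RHS]eq_bigr do rewrite tnth_mktuple mulrDr.
  by rewrite big_split /=; ring.
Qed.

Lemma trunc_quad_moduleZ N (c : R) p : 0 <= c ->
  trunc_quad_module g N p -> trunc_quad_module g N (c *: p).
Proof.
move=> c0 [s0 [s [[hs0 hs] ds0 ds ->]]].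
have sosZ q : sos q -> sos (c *: q).
  by move=> hq; rewrite -mul_mpolyC; apply: sosM hq; exact: sosC.
exists (c *: s0), [tuple c *: tnth s i | i < m]; split.
- by split; [exact: sosZ | move=> i; rewrite tnth_mktuple; exact: sosZ].
- exact: deg_leZ.
- by move=> i; rewrite tnth_mktuple -scalerAl; exact: deg_leZ.
- rewrite scalerDr scaler_sumr; congr (_ + _); apply: eq_bigr => i _.
  by rewrite tnth_mktuple scalerAr.
Qed.

Lemma trunc_quad_moduleC N (c : R) : 0 <= c -> trunc_quad_module g N c%:MP.
Proof.
move=> c0; exists c%:MP, [tuple 0 | i < m]; split.
- by split; [exact: sosC | move=> i; rewrite tnth_mktuple; exact: sos0].
- by rewrite /deg_le msizeC; case: (c != 0).
- by move=> i; rewrite tnth_mktuple mul0r; exact: deg_le0.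
- by rewrite big1 ?addr0 // => i _; rewrite tnth_mktuple mulr0.
Qed.

Lemma quad_module_trunc p : quad_module g p ->
  exists N, forall N', (N <= N')%N -> trunc_quad_module g N' p.
Proof.
move=> [s0 [s [hs0 hs ->]]].
exists (maxn (msize s0) (\max_i msize (tnth s i * tnth g i))) => N'.
rewrite geq_max => /andP[h0 h]; exists s0, s; split=> // [|i]; first exact: leqW.
by apply: leqW; apply: leq_trans h; exact: leq_bigmax.
Qed.

(** Each signed monomial becomes a member of the module after adding a constant. Weighting these
    members by [|p_e|] rebuilds [p], at a total constant that stays below [eps] for small [eta]; [N]
    depends only on the finitely many members. *)
Lemma archimedean_perturbation L (eps : R) : archimedean g -> 0 < eps ->
  exists2 eta, 0 < eta & exists N, forall N', (N <= N')%N -> forall p, deg_le L p ->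
    (forall e : 'X_{1..n < L.+1}, `|p@_e| <= eta) -> trunc_quad_module g N' (p + eps%:MP).
Proof.
move=> hg eps0.
have /boolp.choice[C hC] : forall be : bool * 'X_{1..n < L.+1},
    exists c : nat, quad_module g ((-1) ^+ be.1 *: 'X_[be.2] + c%:R).
  by move=> be; have [c _ hc] := hg ((-1) ^+ be.1 *: 'X_[be.2]); exists c.
have [N hN] := finite_uniform_bound (fun be => quad_module_trunc (hC be)).
(* [D] dominates the sum of the constants for every choice of signs, and [1 + D] is a nonzero
   denominator. *)
pose D : R := \sum_e (C (false, e) + C (true, e))%N%:R.
have D0 : 0 <= D by apply: sumr_ge0.
exists (eps / (1 + D)); first by rewrite divr_gt0 // ltr_pwDl.
exists N => N' NN' p pL pe.
pose c (e : 'X_{1..n < L.+1}) := (C (p@_e < 0, e))%:R : R.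
have -> : p + eps%:MP = \sum_(e : 'X_{1..n < L.+1})
      `|p@_e| *: ((-1) ^+ (p@_e < 0)%R *: 'X_[e] + (C (p@_e < 0, e))%:R)
    + (eps - \sum_(e : 'X_{1..n < L.+1}) `|p@_e| * c e)%:MP.
  under eq_bigr do rewrite scalerDr scalerA mulrC -[_ * `| _ |]numEsign.
  rewrite big_split /= -(mpolywE pL) mpolyCB raddf_sum /=.
  have -> : \sum_(e : 'X_{1..n < L.+1}) `|p@_e| *: (C (p@_e < 0, e))%:R
          = \sum_(e : 'X_{1..n < L.+1}) (`|p@_e| * c e)%:MP :> {mpoly R[n]}.
    by apply: eq_bigr => e _; rewrite mpolyCM mul_mpolyC /c mpolyC_nat.
  ring.
apply: trunc_quad_moduleD.
  apply: (big_ind (trunc_quad_module g N')) => [||e _].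
  - by rewrite -mpolyC0; exact: trunc_quad_moduleC.
  - exact: trunc_quad_moduleD.
  - by apply: trunc_quad_moduleZ => //; exact: (hN (p@_e < 0, e : 'X_{1..n < L.+1})).
apply: trunc_quad_moduleC; rewrite subr_ge0.
apply: le_trans (_ : eps / (1 + D) * D <= _); last first.
  by rewrite mulrAC ler_pdivrMr ?ltr_pwDl // ler_pM2l // lerDr.
rewrite /D mulr_sumr; apply: ler_sum => e _; apply: ler_pM => //.
by rewrite /c ler_nat; case: (p@_e < 0); rewrite ?leq_addr ?leq_addl.
Qed.

End Uniformity.

Unset Implicit Arguments.

Theorem corollary3p3 (R : realType) (n m : nat) (hn : (0 < n)%N) (hm : (0 < m)%N)
    (nrm : nat -> mpoly.mpoly n R -> R)
    (hnrm : forall L : nat, (0 < L)%N -> is_norm_deg_le L (nrm L))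
    (g : m.-tuple (mpoly.mpoly n R)) (hg : archimedean g) :
  forall L : nat, (0 < L)%N ->
    exists2 N : nat, (0 < N)%N &
      forall f : mpoly.mpoly n R,
        deg_le L f ->
        nrm L f <= L%:R ->
        (forall x : 'I_n -> R, semialg g x -> L%:R^-1 <= mpoly.meval x f) ->
        trunc_quad_module g N f.
Proof.
move=> L L0.
pose good (f : {mpoly R[n]}) := [/\ deg_le L f, nrm L f <= L%:R &
  forall x : 'I_n -> R, semialg g x -> L%:R^-1 <= f.@[x]].
pose eps : R := L%:R^-1 / 2.
have Lr : 0 < (L%:R^-1 : R) by rewrite invr_gt0 ltr0n.
have eps0 : 0 < eps by rewrite divr_gt0.
have [eta eta0 [N1 hN1]] := archimedean_perturbation L hg eps0.
have [B B0 hB] := norm_mcoeff_bound L%:R (hnrm L L0).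
have [I [cell hcell]] := @finite_net R n L.+1 B eta eta0.
have [i|N hN] := @finite_uniform_bound I
    (fun i N => forall f, good f -> cell f = i -> trunc_quad_module g N f); last first.
  exists N.+1 => // f fL fn fS; apply: (hN (cell f)) => //; exact: leqnSn.
(* A cell without admissible polynomials satisfies the claim vacuously, with threshold [0]. *)
have [[f0 [[f0L f0n f0S] <-]]|none] := boolp.pselect (exists f0, good f0 /\ cell f0 = i); last first.
  by exists 0%N => N' _ f gf fi; case: none; exists f.
(* On [S_g] the polynomial [f0 - 1/(2L)] is at least [1/(2L) > 0], so Putinar's theorem applies to
   it; the resulting [N2] depends on the cell's representative only. *)
have [|N2 hN2] := quad_module_trunc (putinar (p := f0 - eps%:MP) hg _).
  by move=> x /f0S h; rewrite mevalB mevalC /eps; lra.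
exists (maxn N1 N2) => N'; rewrite geq_max => /andP[N1' N2'] f [fL fn fS] fi.
have -> : f = (f0 - eps%:MP) + ((f - f0) + eps%:MP) by ring.
apply: trunc_quad_moduleD; first exact: hN2.
apply: hN1 => // [|e]; first by apply: deg_leD => //; rewrite -scaleN1r; exact: deg_leZ.
by rewrite mcoeffB; apply: hcell fi _; apply: hB.
Qed.
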